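(* Let $\alpha$ be a unit-speed curve in Euclidean 3-space that is not a straight line, with alternative moving frame $\{N,C,W\}$ and alternative curvatures $f,g$, and let $\varphi(s,v)=\alpha(s)+v\,C(s)$ be the associated $C$-ruled surface. Then the Gaussian curvature $K$ and the mean curvature $H$ of the $C$-ruled surface are $$K=-\frac{f^2\sin^2\left(\int g\,ds\right)}{\left(v^2f^2+\left(\sin\left(\int g\,ds\right)+v g\right)^2\right)^2}$$ and $$H=\frac{v^2(f'g-fg')+v f'\sin\left(\int g\,ds\right)+f\sin\left(\int g\,ds\right)\cos\left(\int g\,ds\right)-v f g\cos\left(\int g\,ds\right)}{2\left(v^2f^2+\left(\sin\left(\int g\,ds\right)+v g\right)^2\right)^{3/2}}.$$
   Context: Let $\alpha(s)$ be a smooth curve in Euclidean 3-space parameterized by arc length $s$; the prime denotes $d/ds$. Its Frenet frame is $T=\alpha'$, $N=(1/\kappa)T'$, $B=T\times N$, with curvature $\kappa=\|T'\|>0$ and torsion $\tau=-\langle B',N\rangle$. The alternative moving frame $\{N,C,W\}$ consists of $N$, $C=N'/\|N'\|$ and $W=(\tau T+\kappa B)/\sqrt{\kappa^2+\tau^2}$; it satisfies $N'=fC$, $C'=-fN+gW$, $W'=-gC$, where the alternative curvatures are $f=\sqrt{\kappa^2+\tau^2}$ and $g=\frac{\kappa^2}{\kappa^2+\tau^2}\left(\frac{\tau}{\kappa}\right)'$. The notation $\int g\,ds$ denotes the antiderivative of $g$ equal to $\arctan(\tau/\kappa)$. The $C$-ruled surface of $\alpha$ (a curve that is not a straight line) is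 $\varphi(s,v)=\alpha(s)+v\,C(s)$. At regular points (where $EG-F^2\ne0$), put $E=\langle\varphi_s,\varphi_s\rangle$, $F=\langle\varphi_s,\varphi_v\rangle$, $G=\langle\varphi_v,\varphi_v\rangle$, and $$L=\frac{\det(\varphi_s,\varphi_v,\varphi_{ss})}{\sqrt{EG-F^2}},\quad M=\frac{\det(\varphi_s,\varphi_v,\varphi_{sv})}{\sqrt{EG-F^2}},\quad \mathcal{N}=\frac{\det(\varphi_s,\varphi_v,\varphi_{vv})}{\sqrt{EG-F^2}}.$$ Then $K=\dfrac{L\mathcal{N}-M^2}{EG-F^2}$ and $H=\dfrac{E\mathcal{N}-2FM+GL}{2(EG-F^2)}$. *)

(* Defs.v *)
From HB Require Import structures.
From mathcomp Require Import all_boot all_order all_algebra.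
From mathcomp Require Import all_classical all_reals all_analysis.
From mathcomp Require Import ring.

Set Implicit Arguments.
Unset Strict Implicit.
Unset Printing Implicit Defensive.

Import Order.TTheory GRing.Theory Num.Theory.
Import numFieldNormedType.Exports.

Local Open Scope classical_set_scope.
Local Open Scope ring_scope.

Section EuclideanSpace.
Context {R : realType}.
Implicit Types u v w : 'rV[R]_3.

Definition dot u v : R := (u *m v^T) 0 0.

(* The norm `|u| of the library on 'rV_3 is the sup norm; it induces the same
   topology, hence the same derivatives, but metric notions must use enorm. *)
Definition enorm u : R := Num.sqrt (dot u u).

Definition cross u v : 'rV[R]_3 :=
  let i0 : 'I_3 := inord 0 in
  let i1 : 'I_3 := inord 1 in
  let i2 : 'I_3 := inord 2 in
  \row_k nth 0 [:: u 0 i1 * v 0 i2 - u 0 i2 * v 0 i1;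
                   u 0 i2 * v 0 i0 - u 0 i0 * v 0 i2;
                   u 0 i0 * v 0 i1 - u 0 i1 * v 0 i0] k.

Definition det3 u v w : R := \det (\matrix_(i < 3) nth 0 [:: u; v; w] i).

End EuclideanSpace.

Section Curves.
Context {R : realType}.
Implicit Types (J : set R) (alpha : R -> 'rV[R]_3).

Definition smooth_on J alpha :=
  forall n s, J s -> derivable (derive1n n alpha) s 1.

Definition unit_speed_on J alpha :=
  forall s, J s -> enorm (derive1 alpha s) = 1.

Definition tangent alpha : R -> 'rV[R]_3 := derive1 alpha.

Definition curvature alpha (s : R) : R := enorm (derive1 (tangent alpha) s).

Definition normal alpha (s : R) : 'rV[R]_3 :=
  (curvature alpha s)^-1 *: derive1 (tangent alpha) s.

Definition binormal alpha (s : R) : 'rV[R]_3 :=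
  cross (tangent alpha s) (normal alpha s).

Definition torsion alpha (s : R) : R :=
  - dot (derive1 (binormal alpha) s) (normal alpha s).

Definition alt_C alpha (s : R) : 'rV[R]_3 :=
  (enorm (derive1 (normal alpha) s))^-1 *: derive1 (normal alpha) s.

Definition alt_f alpha (s : R) : R :=
  Num.sqrt (curvature alpha s ^+ 2 + torsion alpha s ^+ 2).

Definition alt_W alpha (s : R) : 'rV[R]_3 :=
  (alt_f alpha s)^-1 *:
  (torsion alpha s *: tangent alpha s + curvature alpha s *: binormal alpha s).

Definition alt_g alpha (s : R) : R :=
  curvature alpha s ^+ 2 / (curvature alpha s ^+ 2 + torsion alpha s ^+ 2) *
  derive1 (fun t => torsion alpha t / curvature alpha t) s.

(* The antiderivative of alt_g written "int g ds", with the constant of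
   integration fixed by the convention int g ds = arctan (tau / kappa). *)
Definition int_g alpha (s : R) : R :=
  atan (torsion alpha s / curvature alpha s).

Lemma is_derive_int_g alpha (s : R) :
  0 < curvature alpha s ->
  derivable (fun t => torsion alpha t / curvature alpha t) s 1 ->
  is_derive s 1 (int_g alpha) (alt_g alpha s).
Proof.
move=> k0 dq.
set q := fun t => torsion alpha t / curvature alpha t.
have iq : is_derive s 1 q (derive1 q s) by rewrite derive1E; apply: DeriveDef.
have := @is_derive1_comp _ atan q s _ _ (is_derive1_atan (q s)) iq.
rewrite /alt_g /= => h; apply: (is_derive_eq h).
rewrite mulrC [RHS]mulrC -/q; congr (_ * _); rewrite /q.
have kn0 : curvature alpha s != 0 by rewrite gt_eqF.
have pos : curvature alpha s ^+ 2 + torsion alpha s ^+ 2 != 0.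
  by rewrite gt_eqF// ltr_wpDr ?sqr_ge0// exprn_gt0.
by field; rewrite kn0 pos.
Qed.

Definition C_ruled_surface alpha (s v : R) : 'rV[R]_3 :=
  alpha s + v *: alt_C alpha s.

End Curves.

Section Surfaces.
Context {R : realType}.
Implicit Types (X : R -> R -> 'rV[R]_3) (s v : R).

Definition partial_s X s v : 'rV[R]_3 := derive1 (fun t => X t v) s.
Definition partial_v X s v : 'rV[R]_3 := derive1 (fun t => X s t) v.

Definition fff_E X s v : R := dot (partial_s X s v) (partial_s X s v).
Definition fff_F X s v : R := dot (partial_s X s v) (partial_v X s v).
Definition fff_G X s v : R := dot (partial_v X s v) (partial_v X s v).

Definition fff_disc X s v : R :=
  fff_E X s v * fff_G X s v - fff_F X s v ^+ 2.

Definition regular_point X s v : Prop := fff_disc X s v != 0.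

Definition sff_L X s v : R :=
  det3 (partial_s X s v) (partial_v X s v) (partial_s (partial_s X) s v) /
  Num.sqrt (fff_disc X s v).
Definition sff_M X s v : R :=
  det3 (partial_s X s v) (partial_v X s v) (partial_v (partial_s X) s v) /
  Num.sqrt (fff_disc X s v).
Definition sff_N X s v : R :=
  det3 (partial_s X s v) (partial_v X s v) (partial_v (partial_v X) s v) /
  Num.sqrt (fff_disc X s v).

Definition gauss_curvature X s v : R :=
  (sff_L X s v * sff_N X s v - sff_M X s v ^+ 2) / fff_disc X s v.

Definition mean_curvature X s v : R :=
  (fff_E X s v * sff_N X s v - 2 * fff_F X s v * sff_M X s v
   + fff_G X s v * sff_L X s v) / (2 * fff_disc X s v).

End Surfaces.

(* Main.v *)
Require Import Defs.
From mathcomp Require Import all_boot all_order all_algebra.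
From mathcomp Require Import all_classical all_reals all_analysis.
From mathcomp Require Import ring.

(** Put theta = atan (tau / kappa), so that cos theta = kappa / f,
    sin theta = tau / f and theta' = g. The Frenet equations give
    N' = - kappa T + tau B, a vector of norm f, whence
    C = - cos theta T + sin theta B and W = sin theta T + cos theta B: the
    alternative frame is the Frenet frame turned about N. It is therefore
    orthonormal and positively oriented, it satisfies N' = f C,
    C' = - f N + g W, W' = - g C, and T = - cos theta C + sin theta W.

    In the coordinates of (N, C, W), with a = sin theta + v g, the partial
    derivatives of phi = alpha + v C are
    - phi_s = T + v C' = (- v f, - cos theta, a),
    - phi_v = C = (0, 1, 0),
    - phi_ss = T' + v C'' = (f cos theta - v f', - v (f^2 + g^2), v g'),
    - phi_sv = C' = (- f, 0, g), and phi_vv = 0.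

    As phi_v is the middle frame vector, EG - F^2 = v^2 f^2 + a^2, and the
    determinants that define L and M are 2x2 minors of the outer coordinates; in
    M this minor is f sin theta. Both formulas follow by substitution
    ([ruled_curvatures]).

    Differentiating the frames presupposes that kappa, tau, f and g are
    differentiable. They are algebraic expressions, with inverses and square
    roots, in derivatives of alpha, so it suffices that the functions that are
    differentiable to all orders on an open set are closed under these
    operations. The Frenet equations for B and N are then obtained
    ([is_derive_binormal], [is_derive_normal]) by differentiating the cross
    products B = T x N and N = B x T. *)

Import Order.TTheory GRing.Theory Num.Theory.
Import numFieldNormedType.Exports.

Local Open Scope classical_set_scope.
Local Open Scope ring_scope.

Set Implicit Arguments.
Unset Strict Implicit.
Unset Printing Implicit Defensive.

(** * Algebra of oriented Euclidean 3-space *)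

Section VectorAlgebra.
Context {R : realType}.
Implicit Types (a c s x y z : R) (u v w : 'rV[R]_3).

Local Notation i0 := (inord 0 : 'I_3).
Local Notation i1 := (inord 1 : 'I_3).
Local Notation i2 := (inord 2 : 'I_3).

Lemma ord3_cases (P : 'I_3 -> Prop) : P i0 -> P i1 -> P i2 -> forall i, P i.
Proof.
move=> P0 P1 P2 [[|[|[|//]]] ilt].
- by rewrite (_ : Ordinal ilt = i0)//; apply: val_inj; rewrite /= inordK.
- by rewrite (_ : Ordinal ilt = i1)//; apply: val_inj; rewrite /= inordK.
- by rewrite (_ : Ordinal ilt = i2)//; apply: val_inj; rewrite /= inordK.
Qed.

Lemma row3P u v :
  [/\ u 0 i0 = v 0 i0, u 0 i1 = v 0 i1 & u 0 i2 = v 0 i2] -> u = v.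
Proof. by case=> e0 e1 e2; apply/rowP; apply: ord3_cases. Qed.

Lemma ord3E (i : 'I_3) k : i = k :> nat -> i = inord k.
Proof. by move=> <-; rewrite inord_val. Qed.

Lemma sum3E (F : 'I_3 -> R) : \sum_i F i = F i0 + F i1 + F i2.
Proof.
rewrite !big_ord_recl big_ord0 addr0 addrA.
by congr (F _ + F _ + F _); exact: ord3E.
Qed.

Lemma dotE u v :
  dot u v = u 0 i0 * v 0 i0 + u 0 i1 * v 0 i1 + u 0 i2 * v 0 i2.
Proof. by rewrite /dot mxE sum3E !mxE. Qed.

Lemma crossE u v :
  (cross u v 0 i0 = u 0 i1 * v 0 i2 - u 0 i2 * v 0 i1) *
  (cross u v 0 i1 = u 0 i2 * v 0 i0 - u 0 i0 * v 0 i2) *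
  (cross u v 0 i2 = u 0 i0 * v 0 i1 - u 0 i1 * v 0 i0).
Proof.
by rewrite /cross !mxE; rewrite inordK //; rewrite inordK //; rewrite inordK.
Qed.

(** Unlike the coordinates [u 0 (inord k)], this form computes on the ordinals
    built with [lift] that cofactor expansion produces. *)
Lemma row3_nth u :
  exists x : R * R * R, forall i, u 0 i = nth 0 [:: x.1.1; x.1.2; x.2] i.
Proof.
by exists (u 0 i0, u 0 i1, u 0 i2); apply: ord3_cases; rewrite inordK.
Qed.

Lemma det3E u v w : det3 u v w = dot (cross u v) w.
Proof.
rewrite dotE !crossE /det3 (expand_det_row _ 0) !big_ord_recl big_ord0.
rewrite /cofactor !(expand_det_row _ 0) !big_ord_recl !big_ord0.
rewrite /cofactor !det_mx11 !mxE /=.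
have [[[u0 u1] u2] uE] := row3_nth u.
have [[[v0 v1] v2] vE] := row3_nth v.
have [[[w0 w1] w2] wE] := row3_nth w.
rewrite !(uE, vE, wE) !inordK //= /bump /=.
ring.
Qed.

(** Lagrange's formula for the double cross product. *)
Lemma cross_crossl u v w : cross (cross u v) w = dot u w *: v - dot v w *: u.
Proof. by apply: row3P; split; rewrite !(crossE, dotE, mxE); ring. Qed.

Lemma crossC u v : cross u v = - cross v u.
Proof. by apply: row3P; split; rewrite !(crossE, mxE); ring. Qed.

Lemma crossZl a u v : cross (a *: u) v = a *: cross u v.
Proof. by apply: row3P; split; rewrite !(crossE, mxE); ring. Qed.

Lemma crossvv u : cross u u = 0.
Proof. by apply: row3P; split; rewrite !(crossE, mxE); ring. Qed.

Lemma dotC u v : dot u v = dot v u.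
Proof. by rewrite !dotE; ring. Qed.

Lemma dotZl a u v : dot (a *: u) v = a * dot u v.
Proof. by rewrite !dotE !mxE; ring. Qed.

Lemma dot_cross_l u v : dot (cross u v) u = 0.
Proof. by rewrite dotE !crossE; ring. Qed.

Lemma dot_cross_r u v : dot (cross u v) v = 0.
Proof. by rewrite dotE !crossE; ring. Qed.

(** Lagrange's identity. *)
Lemma dot_cross u v :
  dot (cross u v) (cross u v) = dot u u * dot v v - dot u v ^+ 2.
Proof. by rewrite !dotE !crossE; ring. Qed.

Lemma dot_ge0 u : 0 <= dot u u.
Proof. by rewrite dotE -!expr2 !addr_ge0 // sqr_ge0. Qed.

Lemma enorm_sqr u : enorm u ^+ 2 = dot u u.
Proof. by rewrite /enorm sqr_sqrtr // dot_ge0. Qed.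

Definition lincomb u v w x y z := x *: u + y *: v + z *: w.

Definition oriented_frame u v w :=
  [/\ [/\ dot u u = 1, dot v v = 1 & dot w w = 1],
      [/\ dot u v = 0, dot u w = 0 & dot v w = 0] & det3 u v w = 1].

Lemma dot_frame u v w x y z x' y' z' : oriented_frame u v w ->
  dot (lincomb u v w x y z) (lincomb u v w x' y' z') = x * x' + y * y' + z * z'.
Proof.
case=> -[uu vv ww] [uv uw vw] _.
transitivity (x * x' * dot u u + y * y' * dot v v + z * z' * dot w w
  + (x * y' + y * x') * dot u v + (x * z' + z * x') * dot u w
  + (y * z' + z * y') * dot v w).
  by rewrite /lincomb !dotE !mxE; ring.
by rewrite uu vv ww uv uw vw; ring.
Qed.

Lemma det3_frame u v w x y z x' y' z' x'' y'' z'' : oriented_frame u v w ->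
  det3 (lincomb u v w x y z) (lincomb u v w x' y' z')
       (lincomb u v w x'' y'' z'') =
  x * (y' * z'' - z' * y'') - y * (x' * z'' - z' * x'')
  + z * (x' * y'' - y' * x'').
Proof.
case=> _ _ det1; rewrite -[RHS]mulr1 -det1.
by rewrite /lincomb !det3E !dotE !crossE !mxE; ring.
Qed.

(** The frame (v, -u, w) has the same orientation as (u, v, w), and its last two
    vectors are then rotated by the angle with cosine c and sine s. The Frenet
    frame (T, N, B) becomes the alternative frame in this way. *)
Lemma oriented_frame_rotate u v w c s : c ^+ 2 + s ^+ 2 = 1 ->
  oriented_frame u v w ->
  oriented_frame v (- c *: u + s *: w) (s *: u + c *: w).
Proof.
move=> cs uvw.
have -> : - c *: u + s *: w = lincomb u v w (- c) 0 s.
  by rewrite /lincomb scale0r addr0.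
have -> : s *: u + c *: w = lincomb u v w s 0 c.
  by rewrite /lincomb scale0r addr0.
have vE : v = lincomb u v w 0 1 0.
  by rewrite /lincomb !scale0r scale1r add0r addr0.
rewrite [X in oriented_frame X _ _]vE /oriented_frame.
rewrite !(dot_frame _ _ _ _ _ _ uvw) (det3_frame _ _ _ _ _ _ _ _ _ uvw).
by split; [split|split|]; solve [ring | rewrite -[RHS]cs; ring].
Qed.

End VectorAlgebra.

(** * Functions differentiable to all orders on an open set *)

Section Smooth.
Context {R : realType} (J : set R) (J_open : open J).

(** The recursion peels the first derivative off, whereas [derive1n] adds the
    last one. The closure properties below become inductions on [k]: for
    instance, the derivative of 1 / a is a polynomial in a' and 1 / a, and the
    latter has one derivative less to be accounted for. *)
Fixpoint ndiff {V : normedModType R} k (h : R -> V) : Prop :=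
  if k is k'.+1 then
    (forall s, J s -> derivable h s 1) /\ ndiff k' (derive1 h)
  else True.

Definition smooth {V : normedModType R} (h : R -> V) := forall k, ndiff k h.

(** Derivatives on an open set only depend on the values there. The Frenet
    identities hold on [J] only, and this is what lets them be differentiated. *)
Lemma is_derive_eqJ {V : normedModType R} (h1 h2 : R -> V) (s : R) dh :
  (forall t, J t -> h1 t = h2 t) -> J s ->
  is_derive s 1 h1 dh -> is_derive s 1 h2 dh.
Proof.
move=> h12 Js; apply: near_eq_is_derive.
by near=> t; apply: h12; near: t; exact: open_nbhs_nbhs.
Unshelve. all: by end_near. Qed.

Lemma derive1_val {V : normedModType R} (h : R -> V) (s : R) dh :
  is_derive s 1 h dh -> derive1 h s = dh.
Proof. by move=> hd; rewrite derive1E derive_val. Qed.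

Lemma derive1P {V : normedModType R} (h : R -> V) (s : R) :
  derivable h s 1 -> is_derive s 1 h (derive1 h s).
Proof. by rewrite derive1E => /derivableP. Qed.

Lemma ndiff_eqJ {V : normedModType R} k (h1 h2 : R -> V) :
  (forall t, J t -> h1 t = h2 t) -> ndiff k h1 -> ndiff k h2.
Proof.
elim: k h1 h2 => [//|k IH] h1 h2 h12 /= [d1 n1]; split=> [s Js|].
  by have [] := @is_derive_eqJ _ _ _ _ _ h12 Js (derive1P (d1 s Js)).
apply: IH n1 => t Jt; apply/esym/derive1_val.
exact: (is_derive_eqJ h12 Jt (derive1P (d1 t Jt))).
Qed.

Lemma ndiffW {V : normedModType R} k (h : R -> V) : ndiff k.+1 h -> ndiff k h.
Proof. by elim: k h => [//|k IH] h [dh nh]; split=> //; apply: IH. Qed.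

Lemma ndiffS {V : normedModType R} k (h dh : R -> V) :
  (forall s, J s -> is_derive s 1 h (dh s)) -> ndiff k dh -> ndiff k.+1 h.
Proof.
move=> hd ndh; split=> [s Js|]; first by have [] := hd s Js.
by apply: ndiff_eqJ ndh => t Jt; rewrite (derive1_val (hd t Jt)).
Qed.

Lemma ndiff_is_derive {V : normedModType R} k (h : R -> V) (s : R) :
  ndiff k.+1 h -> J s -> is_derive s 1 h (derive1 h s).
Proof. by case=> hd _ Js; exact/derive1P/hd. Qed.

Lemma smooth_eqJ {V : normedModType R} (h1 h2 : R -> V) :
  (forall t, J t -> h1 t = h2 t) -> smooth h1 -> smooth h2.
Proof. by move=> h12 s1 k; apply: ndiff_eqJ (s1 k). Qed.

Lemma smooth_is_derive {V : normedModType R} (h : R -> V) (s : R) :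
  smooth h -> J s -> is_derive s 1 h (derive1 h s).
Proof. by move=> /(_ 1%N); exact: ndiff_is_derive. Qed.

Lemma smooth_derive1 {V : normedModType R} (h : R -> V) :
  smooth h -> smooth (derive1 h).
Proof. by move=> hs k; case: (hs k.+1). Qed.

Lemma smooth_onP (alpha : R -> 'rV[R]_3) : smooth_on J alpha -> smooth alpha.
Proof.
move=> sm k.
suff : forall n, ndiff k (derive1n n alpha) by move=> /(_ 0%N).
by elim: k => [//|k IH] n; split=> [|]; [exact: sm | exact: (IH n.+1)].
Qed.

Implicit Types a b : R -> R.

Lemma ndiffD k a b : ndiff k a -> ndiff k b -> ndiff k (fun t => a t + b t).
Proof.
elim: k a b => [//|k IH] a b na nb.
have [[_ na'] [_ nb']] := (na, nb).
apply: (@ndiffS _ _ _ (fun t => derive1 a t + derive1 b t)); last exact: IH.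
move=> s Js.
exact: (is_deriveD (ndiff_is_derive na Js) (ndiff_is_derive nb Js)).
Qed.

Lemma ndiffM k a b : ndiff k a -> ndiff k b -> ndiff k (fun t => a t * b t).
Proof.
elim: k a b => [//|k IH] a b na nb.
have [[_ na'] [_ nb']] := (na, nb).
apply: (@ndiffS _ _ _ (fun t => a t * derive1 b t + b t * derive1 a t)).
  move=> s Js.
  exact: (is_deriveM (ndiff_is_derive na Js) (ndiff_is_derive nb Js)).
by apply: ndiffD; apply: IH => //; exact: ndiffW.
Qed.

Lemma ndiff_cst k (c : R) : ndiff k (fun=> c).
Proof.
elim: k c => [//|k IH] c.
by apply: (ndiffS (dh := fun=> 0)) => // s _; exact: is_derive_cst.
Qed.

Lemma ndiffN k a : ndiff k a -> ndiff k (fun t => - a t).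
Proof.
move=> na; apply: (@ndiff_eqJ _ _ (fun t => -1 * a t)).
  by move=> t _; rewrite mulN1r.
exact/ndiffM/na/ndiff_cst.
Qed.

Lemma ndiffV k a : (forall s, J s -> a s != 0) ->
  ndiff k a -> ndiff k (fun t => (a t)^-1).
Proof.
move=> a0; elim: k => [//|k IH] na; have [_ na'] := na.
apply: (ndiffS (dh := fun t => - ((a t)^-1 * (a t)^-1) * derive1 a t)).
  move=> s Js; rewrite -expr2 exprVn.
  exact: is_deriveV (a0 s Js) (ndiff_is_derive na Js).
have nV := IH (ndiffW na).
by apply/ndiffM/na'/ndiffN/ndiffM.
Qed.

Lemma ndiff_sqrt k a : (forall s, J s -> 0 < a s) ->
  ndiff k a -> ndiff k (fun t => Num.sqrt (a t)).
Proof.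
move=> a0; elim: k => [//|k IH] na; have [_ na'] := na.
apply: (ndiffS (dh := fun t => (2 * Num.sqrt (a t))^-1 * derive1 a t)).
  move=> s Js; apply: (is_derive1_comp (f := Num.sqrt)).
    exact/is_derive1_sqrt/a0.
  exact: (ndiff_is_derive na Js).
apply: ndiffM => //; apply: ndiffV; last first.
  exact/ndiffM/IH/ndiffW/na/ndiff_cst.
by move=> s Js; rewrite mulf_neq0 // gt_eqF // sqrtr_gt0 a0.
Qed.

Lemma smoothD a b : smooth a -> smooth b -> smooth (fun t => a t + b t).
Proof. by move=> sa sb k; exact: ndiffD. Qed.

Lemma smoothM a b : smooth a -> smooth b -> smooth (fun t => a t * b t).
Proof. by move=> sa sb k; exact: ndiffM. Qed.

Lemma smoothN a : smooth a -> smooth (fun t => - a t).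
Proof. by move=> sa k; exact: ndiffN. Qed.

Lemma smoothV a : (forall s, J s -> a s != 0) ->
  smooth a -> smooth (fun t => (a t)^-1).
Proof. by move=> a0 sa k; exact: ndiffV. Qed.

Lemma smooth_sqrt a : (forall s, J s -> 0 < a s) ->
  smooth a -> smooth (fun t => Num.sqrt (a t)).
Proof. by move=> a0 sa k; exact: ndiff_sqrt. Qed.

Lemma is_derive_rowP n (u : R -> 'rV[R]_n) (s : R) du :
  is_derive s 1 u du <-> forall i, is_derive s 1 (fun t => u t 0 i) (du 0 i).
Proof.
split=> [[ud <-] i|ud].
  have := ud; rewrite derivable_mxP => /(_ 0 i) ui.
  by apply: DeriveDef => //; rewrite derive_mx // mxE.
have uD : derivable u s 1.
  by apply/derivable_mxP => j i; rewrite (ord1 j); have [] := ud i.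
apply: DeriveDef => //; rewrite derive_mx //; apply/rowP => i.
by rewrite mxE; have [_ ->] := ud i.
Qed.

Lemma smooth_rowP n (u : R -> 'rV[R]_n) :
  smooth u <-> forall i, smooth (fun t => u t 0 i).
Proof.
split=> su.
  move=> i k; elim: k u su => [//|k IH] u su.
  apply: (@ndiffS _ _ _ (fun t => derive1 u t 0 i)).
    move=> s Js; apply: (is_derive_rowP u s (derive1 u s)).1.
    exact: smooth_is_derive.
  exact/IH/smooth_derive1.
move=> k; elim: k u su => [//|k IH] u su.
apply: (@ndiffS _ _ _ (fun t => \row_i derive1 (fun t => u t 0 i) t)).
  move=> s Js; apply/is_derive_rowP => i; rewrite mxE.
  exact: smooth_is_derive.
apply: IH => i; apply: smooth_eqJ (smooth_derive1 (su i)) => t _.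
by rewrite mxE.
Qed.

End Smooth.

(** * Calculus of the dot and cross products *)

Section VectorCalculus.
Context {R : realType} (J : set R) (J_open : open J).
Implicit Types (a : R -> R) (u v : R -> 'rV[R]_3) (s : R).

Lemma is_derive_scale a u s da du :
  is_derive s 1 a da -> is_derive s 1 u du ->
  is_derive s 1 (fun t => a t *: u t) (da *: u s + a s *: du).
Proof.
move=> ad /is_derive_rowP ud; apply/is_derive_rowP => i.
have -> : (fun t => (a t *: u t) 0 i) = (fun t => a t * u t 0 i).
  by apply/funext => t; rewrite mxE.
apply: is_derive_eq (is_deriveM ad (ud i)) _.
by rewrite !mxE /GRing.scale /=; ring.
Qed.

Lemma is_derive_dot u v s du dv :
  is_derive s 1 u du -> is_derive s 1 v dv ->
  is_derive s 1 (fun t => dot (u t) (v t)) (dot du (v s) + dot (u s) dv).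
Proof.
move=> /is_derive_rowP ud /is_derive_rowP vd.
have -> : (fun t => dot (u t) (v t)) = (fun t =>
    u t 0 (inord 0) * v t 0 (inord 0) + u t 0 (inord 1) * v t 0 (inord 1)
    + u t 0 (inord 2) * v t 0 (inord 2)).
  by apply/funext => t; rewrite dotE.
apply: is_derive_eq (is_deriveD (is_deriveD (is_deriveM (ud _) (vd _))
  (is_deriveM (ud _) (vd _))) (is_deriveM (ud _) (vd _))) _.
by rewrite !dotE /GRing.scale /=; ring.
Qed.

Lemma is_derive_cross u v s du dv :
  is_derive s 1 u du -> is_derive s 1 v dv ->
  is_derive s 1 (fun t => cross (u t) (v t)) (cross du (v s) + cross (u s) dv).
Proof.
move=> /is_derive_rowP ud /is_derive_rowP vd.
have minor i j : is_derive s 1 (fun t => u t 0 i * v t 0 j - u t 0 j * v t 0 i)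
    (du 0 i * v s 0 j - du 0 j * v s 0 i
     + (u s 0 i * dv 0 j - u s 0 j * dv 0 i)).
  apply: is_derive_eq (is_deriveB (is_deriveM (ud _) (vd _))
    (is_deriveM (ud _) (vd _))) _.
  by rewrite /GRing.scale /=; ring.
apply/is_derive_rowP.
apply: ord3_cases; rewrite [X in is_derive _ _ _ X]mxE !crossE.
- by under eq_fun do rewrite crossE; exact: minor.
- by under eq_fun do rewrite crossE; exact: minor.
- by under eq_fun do rewrite crossE; exact: minor.
Qed.

Lemma dot_unit_derive u s du :
  (forall t, J t -> dot (u t) (u t) = 1) -> J s -> is_derive s 1 u du ->
  dot (u s) du = 0.
Proof.
move=> u1 Js ud.
have d0 : is_derive s 1 (fun t => dot (u t) (u t)) 0.
  apply: (is_derive_eqJ J_open _ Js (is_derive_cst (1 : R) s 1)) => t Jt.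
  by rewrite u1.
have := derive1_val (is_derive_dot ud ud); rewrite (derive1_val d0).
rewrite dotC -mulr2n => /esym/eqP.
by rewrite mulrn_eq0 /= => /eqP.
Qed.

Lemma smoothX a n : smooth J a -> smooth J (fun t => a t ^+ n).
Proof.
move=> sa; elim: n => [|n IH] k; first exact: ndiff_cst.
apply: (ndiff_eqJ J_open (h1 := fun t => a t * a t ^+ n)).
  by move=> t _; rewrite exprS.
exact: ndiffM.
Qed.

Lemma smooth_scale a u :
  smooth J a -> smooth J u -> smooth J (fun t => a t *: u t).
Proof.
move=> sa /(smooth_rowP J_open) su; apply/(smooth_rowP J_open) => i.
by under eq_fun do rewrite mxE; exact: smoothM.
Qed.

Lemma smooth_dot u v :
  smooth J u -> smooth J v -> smooth J (fun t => dot (u t) (v t)).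
Proof.
move=> /(smooth_rowP J_open) su /(smooth_rowP J_open) sv.
under eq_fun do rewrite dotE.
by do ![apply: smoothD => //]; exact: smoothM.
Qed.

Lemma smooth_cross u v :
  smooth J u -> smooth J v -> smooth J (fun t => cross (u t) (v t)).
Proof.
move=> /(smooth_rowP J_open) su /(smooth_rowP J_open) sv.
have minor i j : smooth J (fun t => u t 0 i * v t 0 j - u t 0 j * v t 0 i).
  by apply: smoothD => //; [|apply: smoothN => //]; exact: smoothM.
apply/(smooth_rowP J_open); apply: ord3_cases.
- by under eq_fun do rewrite crossE; exact: minor.
- by under eq_fun do rewrite crossE; exact: minor.
- by under eq_fun do rewrite crossE; exact: minor.
Qed.

End VectorCalculus.

(** * Curvatures of a surface ruled by unit vectors *)

Section SurfaceCurvatures.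
Context {R : realType}.

Lemma powR3half (x : R) : 0 < x -> x `^ (3 / 2) = x * Num.sqrt x.
Proof.
move=> x0; have -> : 3 / 2 = 1 + 2^-1 :> R by field.
by rewrite powRD ?(gt_eqF x0) ?implybT // powRr1 ?powR12_sqrt // ltW.
Qed.

(** A surface that is ruled in the v direction by unit vectors e2 has G = 1 and a
    vanishing third second-form coefficient, so that K = - M^2 / D and
    H = (L - 2 F M) / (2 D). In an oriented orthonormal frame containing e2, the
    determinants against e2 are 2x2 minors of the e1, e3 coordinates, and F is
    the e2 coordinate q of the s-partial. *)
Lemma ruled_curvatures (X : R -> R -> 'rV[R]_3) (s t : R) e1 e2 e3
    (p q r x y z a b c : R) :
  oriented_frame e1 e2 e3 ->
  partial_s X s t = lincomb e1 e2 e3 p q r ->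
  partial_v X s t = e2 ->
  partial_s (partial_s X) s t = lincomb e1 e2 e3 x y z ->
  partial_v (partial_s X) s t = lincomb e1 e2 e3 a b c ->
  partial_v (partial_v X) s t = 0 ->
  regular_point X s t ->
  gauss_curvature X s t = - ((p * c - r * a) ^+ 2 / (p ^+ 2 + r ^+ 2) ^+ 2) /\
  mean_curvature X s t =
    ((p * z - r * x) - 2 * q * (p * c - r * a)) /
    (2 * (p ^+ 2 + r ^+ 2) `^ (3 / 2)).
Proof.
move=> e123 Xs Xv Xss Xsv Xvv.
have e2E : e2 = lincomb e1 e2 e3 0 1 0.
  by rewrite /lincomb !scale0r scale1r add0r addr0.
have e0E : 0 = lincomb e1 e2 e3 0 0 0 by rewrite /lincomb !scale0r !addr0.
have EE : fff_E X s t = p ^+ 2 + q ^+ 2 + r ^+ 2.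
  by rewrite /fff_E Xs (dot_frame _ _ _ _ _ _ e123) -!expr2.
have FE : fff_F X s t = q.
  by rewrite /fff_F Xs Xv [X in dot _ X]e2E (dot_frame _ _ _ _ _ _ e123); ring.
have GE : fff_G X s t = 1.
  by rewrite /fff_G Xv e2E (dot_frame _ _ _ _ _ _ e123); ring.
have DE : fff_disc X s t = p ^+ 2 + r ^+ 2.
  by rewrite /fff_disc EE FE GE; ring.
rewrite /regular_point DE => D0.
have D_gt0 : 0 < p ^+ 2 + r ^+ 2 by rewrite lt0r D0 addr_ge0 // sqr_ge0.
have LE : sff_L X s t = (p * z - r * x) / Num.sqrt (p ^+ 2 + r ^+ 2).
  rewrite /sff_L DE Xs Xv Xss [X in det3 _ X]e2E.
  rewrite (det3_frame _ _ _ _ _ _ _ _ _ e123).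
  by congr (_ / _); ring.
have ME : sff_M X s t = (p * c - r * a) / Num.sqrt (p ^+ 2 + r ^+ 2).
  rewrite /sff_M DE Xs Xv Xsv [X in det3 _ X]e2E.
  rewrite (det3_frame _ _ _ _ _ _ _ _ _ e123).
  by congr (_ / _); ring.
have NE : sff_N X s t = 0.
  rewrite /sff_N Xs Xv Xvv [X in det3 _ X]e2E [X in det3 _ _ X]e0E.
  by rewrite (det3_frame _ _ _ _ _ _ _ _ _ e123); ring.
rewrite /gauss_curvature /mean_curvature LE ME NE EE FE GE DE powR3half //.
have := sqr_sqrtr (ltW D_gt0).
have : Num.sqrt (p ^+ 2 + r ^+ 2) != 0 by rewrite gt_eqF // sqrtr_gt0.
(* with d the square root of D, both sides are rational functions of d *)
move: (Num.sqrt _) => d d0 <-.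
by split; field.
Qed.

Lemma derive1_affine (u w : 'rV[R]_3) (t : R) :
  derive1 (fun t => u + t *: w) t = w.
Proof.
have := is_deriveD (is_derive_cst u t 1)
  (is_derive_scale (is_derive_id t 1) (is_derive_cst w t 1)).
by move/derive1_val => ->; rewrite scaler0 add0r addr0 scale1r.
Qed.

End SurfaceCurvatures.

(** * Frenet and alternative frames, and the C-ruled surface *)

Section CRuledSurface.
Context {R : realType} (J : set R) (alpha : R -> 'rV[R]_3).
Hypotheses (J_open : open J) (alpha_smooth : smooth_on J alpha)
  (alpha_unit : unit_speed_on J alpha)
  (alpha_curv : forall s : R, J s -> 0 < curvature alpha s).

Local Notation T := (tangent alpha).
Local Notation N := (normal alpha).
Local Notation B := (binormal alpha).
Local Notation C := (alt_C alpha).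
Local Notation W := (alt_W alpha).
Local Notation kappa := (curvature alpha).
Local Notation tau := (torsion alpha).
Local Notation f := (alt_f alpha).
Local Notation g := (alt_g alpha).
Local Notation theta := (int_g alpha).
Local Notation X := (C_ruled_surface alpha).

Lemma smooth_tangent : smooth J T.
Proof. exact/smooth_derive1/smooth_onP. Qed.

Lemma smooth_curvature : smooth J kappa.
Proof.
apply: smooth_sqrt => // [s Js|]; first by rewrite -sqrtr_gt0; exact: alpha_curv.
by apply: smooth_dot => //; exact/smooth_derive1/smooth_tangent.
Qed.

Lemma curvature_neq0 s : J s -> kappa s != 0.
Proof. by move=> /alpha_curv; exact: lt0r_neq0. Qed.

Lemma smooth_normal : smooth J N.
Proof.
apply: smooth_scale => //; last exact/smooth_derive1/smooth_tangent.
by apply: smoothV => //; [exact: curvature_neq0 | exact: smooth_curvature].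
Qed.

Lemma smooth_binormal : smooth J B.
Proof.
by apply: smooth_cross => //; [exact: smooth_tangent | exact: smooth_normal].
Qed.

Lemma smooth_torsion : smooth J tau.
Proof.
apply: smoothN => //; apply: smooth_dot => //; last exact: smooth_normal.
exact/smooth_derive1/smooth_binormal.
Qed.

Lemma alt_f_sqr s : f s ^+ 2 = kappa s ^+ 2 + tau s ^+ 2.
Proof. by rewrite sqr_sqrtr // addr_ge0 // sqr_ge0. Qed.

Lemma curvature_torsion_gt0 s : J s -> 0 < kappa s ^+ 2 + tau s ^+ 2.
Proof. by move=> /alpha_curv k0; rewrite ltr_wpDr ?sqr_ge0 // exprn_gt0. Qed.

Lemma alt_f_gt0 s : J s -> 0 < f s.
Proof. by move=> Js; rewrite sqrtr_gt0 curvature_torsion_gt0. Qed.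

Lemma smooth_curvature_torsion : smooth J (fun t => kappa t ^+ 2 + tau t ^+ 2).
Proof.
by apply: smoothD => //; apply: smoothX => //;
  [exact: smooth_curvature | exact: smooth_torsion].
Qed.

Lemma smooth_alt_f : smooth J f.
Proof.
apply: smooth_sqrt => //; first exact: curvature_torsion_gt0.
exact: smooth_curvature_torsion.
Qed.

Lemma smooth_torsion_over_curvature : smooth J (fun t => tau t / kappa t).
Proof.
apply: smoothM => //; first exact: smooth_torsion.
by apply: smoothV => //; [exact: curvature_neq0 | exact: smooth_curvature].
Qed.

Lemma smooth_alt_g : smooth J g.
Proof.
apply: smoothM => //; last exact/smooth_derive1/smooth_torsion_over_curvature.
apply: smoothM => //; first exact/smoothX/smooth_curvature.
apply: smoothV => //; last exact: smooth_curvature_torsion.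
by move=> s Js; rewrite lt0r_neq0 // curvature_torsion_gt0.
Qed.

Lemma tangent_unit s : J s -> dot (T s) (T s) = 1.
Proof. by move=> Js; rewrite -enorm_sqr /tangent alpha_unit // expr1n. Qed.

Lemma is_derive_tangent s : J s -> is_derive s 1 T (kappa s *: N s).
Proof.
move=> Js; rewrite /normal scalerA divff ?curvature_neq0 // scale1r.
exact: smooth_is_derive smooth_tangent Js.
Qed.

Lemma normal_unit s : J s -> dot (N s) (N s) = 1.
Proof.
move=> Js; rewrite /normal dotZl dotC dotZl -enorm_sqr -/(curvature alpha s).
by rewrite mulrA -expr2 -exprMn mulVf ?expr1n // curvature_neq0.
Qed.

Lemma tangent_normal s : J s -> dot (T s) (N s) = 0.
Proof.
move=> Js; have := dot_unit_derive J_open tangent_unit Js (is_derive_tangent Js).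
rewrite dotC dotZl dotC => /eqP.
by rewrite mulf_eq0 (negPf (curvature_neq0 Js)) => /eqP.
Qed.

Lemma binormal_unit s : J s -> dot (B s) (B s) = 1.
Proof.
move=> Js; rewrite dot_cross tangent_unit // normal_unit // tangent_normal //.
by rewrite expr0n mulr1 subr0.
Qed.

Lemma frenet_frame s : J s -> oriented_frame (T s) (N s) (B s).
Proof.
move=> Js; split; last by rewrite det3E binormal_unit.
  by rewrite tangent_unit // normal_unit // binormal_unit.
by rewrite tangent_normal // ![dot _ (B s)]dotC dot_cross_l dot_cross_r.
Qed.

(** As T' is parallel to N, B' = T x N'. The double cross product of B' and N is
    then 0 because N is orthogonal to T and N', so B' is a multiple of N; the
    coefficient is - tau by definition of the torsion. *)
Lemma is_derive_binormal s : J s -> is_derive s 1 B (- tau s *: N s).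
Proof.
move=> Js; have Nd := smooth_is_derive smooth_normal Js.
have Bd := is_derive_cross (is_derive_tangent Js) Nd.
rewrite crossZl crossvv scaler0 add0r in Bd.
apply: is_derive_eq Bd _.
have -> : - tau s = dot (cross (T s) (derive1 N s)) (N s).
  rewrite opprK (derive1_val (is_derive_cross (is_derive_tangent Js) Nd)).
  by rewrite crossZl crossvv scaler0 add0r.
set b := cross _ _.
have bN : cross b (N s) = 0.
  rewrite cross_crossl tangent_normal // scale0r sub0r dotC.
  by rewrite (dot_unit_derive J_open normal_unit Js Nd) scale0r oppr0.
have := cross_crossl b (N s) (N s); rewrite bN.
have -> : cross 0 (N s) = 0 by rewrite -(scale0r 0) crossZl !scale0r.
by rewrite normal_unit // scale1r => /esym/eqP; rewrite subr_eq0 => /eqP.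
Qed.

Lemma cross_binormal_tangent s : J s -> cross (B s) (T s) = N s.
Proof.
move=> Js; rewrite cross_crossl tangent_unit // dotC tangent_normal //.
by rewrite scale1r scale0r subr0.
Qed.

Lemma cross_binormal_normal s : J s -> cross (B s) (N s) = - T s.
Proof.
move=> Js; rewrite cross_crossl normal_unit // tangent_normal //.
by rewrite scale1r scale0r sub0r.
Qed.

(** Obtained by differentiating N = B x T. *)
Lemma is_derive_normal s :
  J s -> is_derive s 1 N (- kappa s *: T s + tau s *: B s).
Proof.
move=> Js; apply: (is_derive_eqJ J_open (fun t Jt => cross_binormal_tangent Jt) Js).
apply: is_derive_eq
  (is_derive_cross (is_derive_binormal Js) (is_derive_tangent Js)) _.
rewrite crossZl (crossC (N s)) -/(binormal alpha s).
rewrite (crossC (B s) (_ *: _)) crossZl (crossC (N s)) cross_binormal_normal //.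
by rewrite opprK scaleNr !scalerN opprK addrC scaleNr.
Qed.

(** The angle theta = atan (tau / kappa) is the one with cosine kappa / f and sine
    tau / f; kappa > 0 fixes the signs. *)
Lemma cos_int_g s : J s -> cos (theta s) = kappa s / f s.
Proof.
move=> Js; have k0 := alpha_curv Js; have kn := lt0r_neq0 k0.
have -> : f s = kappa s * Num.sqrt (1 + (tau s / kappa s) ^+ 2).
  rewrite -[X in X * _](gtr0_norm k0) -sqrtr_sqr -sqrtrM ?sqr_ge0 //.
  by congr Num.sqrt; field.
by rewrite cos_atan invfM mulrA divff // mul1r.
Qed.

Lemma sin_int_g s : J s -> sin (theta s) = tau s / f s.
Proof.
move=> Js; have kn := curvature_neq0 Js; have fn := lt0r_neq0 (alt_f_gt0 Js).
have cn : cos (theta s) != 0 by rewrite cos_int_g // mulf_neq0 ?invr_eq0.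
have := atanK (tau s / kappa s); rewrite -/(theta s) /tan => tE.
rewrite -[LHS](divfK cn) tE cos_int_g //.
by field; rewrite fn kn.
Qed.

Lemma is_derive_theta s : J s -> is_derive s 1 theta (g s).
Proof.
move=> Js; apply: is_derive_int_g; first exact: alpha_curv.
by have [] := smooth_is_derive smooth_torsion_over_curvature Js.
Qed.

(** N' = - kappa T + tau B has norm f, so C is N' / f. *)
Lemma alt_CE s :
  J s -> C s = - cos (theta s) *: T s + sin (theta s) *: B s.
Proof.
move=> Js; have N' := derive1_val (is_derive_normal Js).
have nN : enorm (derive1 N s) = f s.
  rewrite /enorm N' /alt_f; congr Num.sqrt.
  have -> : - kappa s *: T s + tau s *: B s =
      lincomb (T s) (N s) (B s) (- kappa s) 0 (tau s).
    by rewrite /lincomb scale0r addr0.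
  by rewrite (dot_frame _ _ _ _ _ _ (frenet_frame Js)); ring.
rewrite /alt_C nN N' scalerDr !scalerA cos_int_g // sin_int_g //.
by congr (_ *: _ + _ *: _); ring.
Qed.

Lemma alt_WE s :
  J s -> W s = sin (theta s) *: T s + cos (theta s) *: B s.
Proof.
move=> Js; rewrite /alt_W scalerDr !scalerA cos_int_g // sin_int_g //.
by rewrite ![(f s)^-1 * _]mulrC.
Qed.

Lemma is_derive_normal_alt s : J s -> is_derive s 1 N (f s *: C s).
Proof.
move=> Js; apply: is_derive_eq (is_derive_normal Js) _.
rewrite alt_CE // cos_int_g // sin_int_g // scalerDr !scalerA.
have fn := lt0r_neq0 (alt_f_gt0 Js).
by congr (_ *: _ + _ *: _); field.
Qed.

Let is_derive_cos_theta s : J s ->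
  is_derive s 1 (fun t => cos (theta t)) (- sin (theta s) * g s).
Proof.
by move=> Js; exact: (is_derive1_comp (is_derive_cos _) (is_derive_theta Js)).
Qed.

Let is_derive_sin_theta s : J s ->
  is_derive s 1 (fun t => sin (theta t)) (cos (theta s) * g s).
Proof.
by move=> Js; exact: (is_derive1_comp (is_derive_sin _) (is_derive_theta Js)).
Qed.

(** The T and B components of C' carry the factor theta' = g, and its N component
    is - (kappa cos theta + tau sin theta) = - f. *)
Lemma is_derive_alt_C s :
  J s -> is_derive s 1 C (- f s *: N s + g s *: W s).
Proof.
move=> Js; apply: (is_derive_eqJ J_open (fun t Jt => esym (alt_CE Jt)) Js).
apply: is_derive_eq (is_deriveD
  (is_derive_scale (is_deriveN (is_derive_cos_theta Js)) (is_derive_tangent Js))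
  (is_derive_scale (is_derive_sin_theta Js) (is_derive_binormal Js))) _.
have -> : f s = cos (theta s) * kappa s + sin (theta s) * tau s.
  have fn := lt0r_neq0 (alt_f_gt0 Js).
  rewrite cos_int_g // sin_int_g // -![_ / f s * _]mulrAC -mulrDl -!expr2.
  by rewrite -alt_f_sqr expr2 mulfK.
rewrite alt_WE // opprfctE; move: (T s) (N s) (B s) => t n b.
by apply/rowP => i; rewrite !mxE; ring.
Qed.

(** The N component kappa sin theta - tau cos theta of W' vanishes. *)
Lemma is_derive_alt_W s : J s -> is_derive s 1 W (- g s *: C s).
Proof.
move=> Js; apply: (is_derive_eqJ J_open (fun t Jt => esym (alt_WE Jt)) Js).
apply: is_derive_eq (is_deriveD
  (is_derive_scale (is_derive_sin_theta Js) (is_derive_tangent Js))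
  (is_derive_scale (is_derive_cos_theta Js) (is_derive_binormal Js))) _.
have sk : sin (theta s) * kappa s = cos (theta s) * tau s.
  by rewrite cos_int_g // sin_int_g // mulrAC [RHS]mulrAC [kappa s * _]mulrC.
have N0 : (sin (theta s) * kappa s - cos (theta s) * tau s) *: N s = 0.
  by rewrite sk subrr scale0r.
rewrite alt_CE // -[RHS]addr0 -N0; move: (T s) (N s) (B s) => t n b.
by apply/rowP => i; rewrite !mxE; ring.
Qed.

Lemma alternative_frame s : J s -> oriented_frame (N s) (C s) (W s).
Proof.
move=> Js; rewrite alt_CE // alt_WE //.
by apply: oriented_frame_rotate (frenet_frame Js); exact: cos2Dsin2.
Qed.

Lemma tangent_alt s : J s ->
  T s = - cos (theta s) *: C s + sin (theta s) *: W s.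
Proof.
move=> Js; rewrite alt_CE // alt_WE //.
rewrite -[LHS]scale1r -(cos2Dsin2 (theta s)); move: (T s) (B s) => t b.
by apply/rowP => i; rewrite !mxE; ring.
Qed.

Lemma partial_s_surface s v : J s ->
  partial_s X s v = T s + v *: (- f s *: N s + g s *: W s).
Proof.
move=> Js; apply: derive1_val; apply: is_deriveD; last first.
  exact: (is_deriveZ v (is_derive_alt_C Js)).
by apply: (smooth_is_derive _ Js); exact: smooth_onP.
Qed.

(** C'' is the derivative of - f N + g W along the moving frame, and
    T' = kappa N with kappa = f cos theta. *)
Lemma partial_ss_surface s v : J s ->
  partial_s (partial_s X) s v =
  lincomb (N s) (C s) (W s) (f s * cos (theta s) - v * derive1 f s)
    (- (v * (f s ^+ 2 + g s ^+ 2))) (v * derive1 g s).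
Proof.
move=> Js; apply: derive1_val.
apply: (is_derive_eqJ J_open (fun t Jt => esym (partial_s_surface v Jt)) Js).
have fd := smooth_is_derive smooth_alt_f Js.
have gd := smooth_is_derive smooth_alt_g Js.
have Td := is_derive_tangent Js.
have Nd := is_derive_normal_alt Js.
have Wd := is_derive_alt_W Js.
have C'd :=
  is_deriveD (is_derive_scale (is_deriveN fd) Nd) (is_derive_scale gd Wd).
apply: is_derive_eq (is_deriveD Td (is_deriveZ v C'd)) _.
have -> : curvature alpha s = f s * cos (theta s).
  by rewrite cos_int_g // mulrC divfK // lt0r_neq0 // alt_f_gt0.
rewrite /lincomb opprfctE; move: (N s) (C s) (W s) => n c w.
by apply/rowP => i; rewrite !mxE; ring.
Qed.

Lemma partial_v_surface s v : partial_v X s v = C s.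
Proof. exact: derive1_affine. Qed.

End CRuledSurface.

Unset Implicit Arguments.

Theorem corollary3p7 (R : realType) (J : set R) (alpha : R -> 'rV[R]_3)
    (J_open : open J) (J_itv : is_interval J)
    (alpha_smooth : smooth_on J alpha)
    (alpha_unit : unit_speed_on J alpha)
    (alpha_curv : forall s : R, J s -> 0 < curvature alpha s) :
  let f := alt_f alpha in
  let g := alt_g alpha in
  let theta := int_g alpha in
  let X := C_ruled_surface alpha in
  forall s v : R, J s -> regular_point X s v ->
  gauss_curvature X s v =
    - (f s ^+ 2 * sin (theta s) ^+ 2 /
       (v ^+ 2 * f s ^+ 2 + (sin (theta s) + v * g s) ^+ 2) ^+ 2)
  /\
  mean_curvature X s v =
    (v ^+ 2 * (derive1 f s * g s - f s * derive1 g s)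
     + v * derive1 f s * sin (theta s)
     + f s * sin (theta s) * cos (theta s)
     - v * f s * g s * cos (theta s)) /
    (2 * (v ^+ 2 * f s ^+ 2 + (sin (theta s) + v * g s) ^+ 2) `^ (3 / 2)).
Proof.
move=> f g theta X s v Js reg.
have Xs w : partial_s X s w = lincomb (normal alpha s) (alt_C alpha s)
    (alt_W alpha s) (- (w * f s)) (- cos (theta s)) (sin (theta s) + w * g s).
  rewrite (partial_s_surface J_open) // (tangent_alt J_open) // /lincomb.
  rewrite /f /g /theta.
  move: (normal alpha s) (alt_C alpha s) (alt_W alpha s) => n c a.
  by apply/rowP => i; rewrite !mxE; ring.
have Xsv : partial_v (partial_s X) s v =
    lincomb (normal alpha s) (alt_C alpha s) (alt_W alpha s) (- f s) 0 (g s).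
  rewrite /partial_v; under eq_fun do rewrite (partial_s_surface J_open) //.
  by rewrite derive1_affine /lincomb scale0r addr0.
have Xvv : partial_v (partial_v X) s v = 0.
  rewrite {1}/partial_v; under eq_fun do rewrite partial_v_surface.
  exact: derive1_cst.
(* the minor p c - r a of ruled_curvatures is here f sin theta *)
have [-> ->] := ruled_curvatures
  (alternative_frame J_open alpha_smooth alpha_unit alpha_curv Js)
  (Xs v) (partial_v_surface alpha s v)
  (partial_ss_surface J_open alpha_smooth alpha_unit alpha_curv v Js) Xsv Xvv reg.
have -> : (- (v * f s)) ^+ 2 + (sin (theta s) + v * g s) ^+ 2 =
  v ^+ 2 * f s ^+ 2 + (sin (theta s) + v * g s) ^+ 2 by ring.
rewrite -/f -/g -/theta.
by split; [congr (- (_ / _)) | congr (_ / _)]; ring.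
Qed.
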